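(* Let $\Gamma=(V,H)$ be an oriented hypergraph in which no vertex has degree zero, and let $\lambda_1$ and $\lambda_n$ be the smallest and largest eigenvalues of the normalized Laplacian $\Delta_2$, i.e. $\lambda_1=\min_{f\ne0}\mathrm{RQ}_2(f)$ and $\lambda_n=\max_{f\ne0}\mathrm{RQ}_2(f)$. Let $1\le l<k$ be integers. For any $(k,l)$-family $(S_1,\ldots,S_k)$ with $S_1\cup\cdots\cup S_k\ne\emptyset$, $$\lambda_1\le\frac{k\,(e(S_1)+\cdots+e(S_k))-l^2\,e(S_1\cup\cdots\cup S_k)}{(k-l)\,l\,\mathrm{vol}(S_1\cup\cdots\cup S_k)}\le\lambda_n.$$
   Context: An oriented hypergraph $\Gamma=(V,H)$ consists of a finite vertex set $V$ and a finite set $H$ of hyperedges, each a pair $(h_{in},h_{out})$ of disjoint subsets of $V$ with nonempty union. $\deg(i)$ = number of hyperedges $h$ with $i\in h_{in}\cup h_{out}$ (assumed $\ge1$); $\mathrm{vol}(S)=\sum_{i\in S}\deg(i)$. For $S\subseteq V$, $e(S)=\sum_{h\in H}(\#(S\cap h_{in})-\#(S\cap h_{out}))^2$. $\mathrm{RQ}_2(f)=\frac{\sum_{h\in H}(\sum_{i\in h_{in}}f(i)-\sum_{j\in h_{out}}f(j))^2}{\sum_{i\in V}\deg(i)f(i)^2}$. A $k$-tuple $(S_1,\ldots,S_k)$ of subsets of $V$ is a $(k,l)$-family if every vertex of $S_1\cup\cdots\cup S_k$ lies in exactly $l$ of the sets $S_r$. *)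

(* Defs.v *)
From HB Require Import structures.
From mathcomp Require Import all_boot all_order all_algebra.
From mathcomp Require Import classical_sets reals.

Set Implicit Arguments.
Unset Strict Implicit.
Unset Printing Implicit Defensive.

Import Order.TTheory GRing.Theory Num.Theory.
Local Open Scope ring_scope.

(* A hyperedge h = (h_in, h_out) is encoded as a pair: h.1 = h_in and
   h.2 = h_out. *)
Record oriented_hypergraph (V : finType) := OrientedHypergraph {
  hyperedges : {set {set V} * {set V}};
  hyperedge_disjoint : forall h, h \in hyperedges -> [disjoint h.1 & h.2];
  hyperedge_neq0 : forall h, h \in hyperedges -> h.1 :|: h.2 != finset.set0
}.

Section OrientedHypergraph.
Variables (V : finType) (G : oriented_hypergraph V).

Definition deg (i : V) : nat :=
  #|[set h in hyperedges G | i \in h.1 :|: h.2]|.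

Definition vol (S : {set V}) : nat := (\sum_(i in S) deg i)%N.

Section Real.
Variable R : realType.
Implicit Types (S : {set V}) (f : {ffun V -> R}).

Definition e S : R :=
  \sum_(h in hyperedges G) (#|S :&: h.1|%:R - #|S :&: h.2|%:R) ^+ 2.

Definition boundary f (h : {set V} * {set V}) : R :=
  \sum_(i in h.1) f i - \sum_(j in h.2) f j.

(* The normalized Laplacian Delta_2. Its i-th value is 1 / deg i times the sum,
   over the hyperedges h containing i, of the values of f on the vertices of h
   lying on the same side as i minus those on the side opposite to i. *)
Definition laplacian2 f : {ffun V -> R} :=
  [ffun i => (\sum_(h in hyperedges G | i \in h.1) boundary f h
              - \sum_(h in hyperedges G | i \in h.2) boundary f h)
             / (deg i)%:R].

Definition laplacian2_eigenvalue (a : R) : Prop :=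
  exists2 f, f != 0 & forall i, laplacian2 f i = a * f i.

Definition RQ2 f : R :=
  (\sum_(h in hyperedges G) boundary f h ^+ 2)
    / (\sum_i (deg i)%:R * f i ^+ 2).

Definition RQ2_value (a : R) : Prop := exists2 f, f != 0 & RQ2 f = a.

End Real.
End OrientedHypergraph.

Definition is_min (R : realType) (A : set R) (m : R) : Prop :=
  A m /\ lbound A m.

Definition is_max (R : realType) (A : set R) (m : R) : Prop :=
  A m /\ ubound A m.

Definition kl_family (V : finType) (k l : nat) (S : 'I_k -> {set V}) : Prop :=
  forall i, i \in \bigcup_(r < k) S r -> #|[set r | i \in S r]| = l.

(* Main.v *)
Require Import Defs.
From HB Require Import structures.
From mathcomp Require Import all_boot all_order all_algebra.
From mathcomp Require Import classical_sets reals.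
From mathcomp Require Import boolp topology normedtype derive.
From mathcomp Require Import ring lra.

Set Implicit Arguments.
Unset Strict Implicit.
Unset Printing Implicit Defensive.

Import Order.TTheory GRing.Theory Num.Theory.
Import numFieldNormedType.Exports passmx.
Local Open Scope ring_scope.

(** On functions V -> R the numerator and denominator of RQ_2 are symmetric
    bilinear forms, and Delta_2 represents the first one, E, with respect to the
    second one, D.  The Rayleigh quotient E / D attains its minimum c by
    compactness of a unit sphere; a minimiser f is a critical point of the
    nonnegative quadratic function E - c D, so E(f, g) = c D(f, g) for all g,
    i.e. Delta_2 f = c f.  Hence lambda_1 D <= E <= lambda_n D, the second
    inequality being the first one for - E.

    For vectors a_1, ..., a_k, Lagrange's identity writes
    k sum_r B(a_r, a_r) - B(sum_r a_r, sum_r a_r) as one half of the sum of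
    B(a_r - a_s, a_r - a_s) over all pairs (r, s), so these dispersions satisfy
    the same inequalities as E and D.  The indicators of a (k,l)-family add up
    to l times the indicator of the union U, and their dispersions are the
    numerator k sum_r e(S_r) - l^2 e(U) for E and the denominator
    (k - l) l vol(U) for D. *)

HB.factory Record isSymmetricForm (R : comNzRingType) (U : lmodType R)
    (f : U -> U -> R) := {
  form_symmetric : forall u v, f u v = f v u;
  form_linearl : forall v, scalar (f ^~ v)
}.

HB.builders Context R U f of isSymmetricForm R U f.

Let form_linearr u : GRing.linear_for (idfun \; *%R) (f u).
Proof.
by move=> a v w; rewrite form_symmetric form_linearl !(form_symmetric _ u).
Qed.

HB.instance Definition _ := isBilinear.Build R U U R *%R (idfun \; *%R) f
  (fun v => zmod_morphism_linear (form_linearl v))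
  (fun u => zmod_morphism_linear (form_linearr u))
  (fun v => scalable_linear (form_linearl v))
  (fun u => scalable_linear (form_linearr u)).

Let form_hermitian u v : f u v = (-1) ^+ false * idfun (f v u).
Proof. by rewrite expr0 mul1r form_symmetric. Qed.

HB.instance Definition _ :=
  isHermitianSesquilinear.Build R U false idfun f form_hermitian.

HB.end.

Section SymmetricForms.
Variables (R : comNzRingType) (U : lmodType R).
Implicit Types (B : {symmetric U}) (u v : U).

Lemma symformC B u v : B u v = B v u.
Proof. by rewrite hermC expr0 mul1r. Qed.

Lemma symform_addZ B u v t :
  B (u + t *: v) (u + t *: v) = B u u + B u v * t *+ 2 + B v v * t ^+ 2.
Proof. by rewrite hnormD linearZl_LR !linearZr_LR /=; ring. Qed.

Lemma symformZ B t u : B (t *: u) (t *: u) = t ^+ 2 * B u u.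
Proof. by rewrite linearZl_LR linearZr_LR /= mulrA. Qed.

Definition opp_form B u v := - B u v.

Lemma opp_form_sym B u v : opp_form B u v = opp_form B v u.
Proof. by rewrite /opp_form symformC. Qed.

Lemma opp_form_linearl B v : scalar (opp_form B ^~ v).
Proof. by move=> a u1 u2; rewrite /opp_form linearPl opprD mulrN. Qed.

HB.instance Definition _ B := isSymmetricForm.Build R U (opp_form B)
  (opp_form_sym B) (opp_form_linearl B).

Section Dispersion.
Variables (I : finType) (a : I -> U).

Definition dispersion B : R :=
  #|I|%:R * (\sum_i B (a i) (a i)) - B (\sum_i a i) (\sum_i a i).

Lemma sum_form_sub B :
  \sum_i \sum_j B (a i - a j) (a i - a j) = dispersion B *+ 2.
Proof.
have subE i j : B (a i - a j) (a i - a j) =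
    B (a i) (a i) + B (a j) (a j) - B (a i) (a j) *+ 2.
  by rewrite hnormB /=; ring.
under eq_bigr => i _ do
  rewrite (eq_bigr _ (fun j _ => subE i j)) sumrB big_split sumr_const /=
    sumrMnl -linear_sumr.
rewrite sumrB big_split sumr_const /= !sumrMnl -linear_sumlz /dispersion.
by ring.
Qed.

End Dispersion.
End SymmetricForms.

Lemma linear_coef_eq0 (R : realFieldType) (a b : R) :
  (forall t, 0 <= a * t + b * t ^+ 2) -> a = 0.
Proof.
move=> q_ge0; pose m := b ^+ 2 + 1.
have m_gt0 : 0 < m by rewrite ltr_wpDl ?sqr_ge0.
have b_lt_m : 0 < m - b by rewrite /m; nra.
have := q_ge0 (- (a / m)).
have -> : a * - (a / m) + b * (- (a / m)) ^+ 2 =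
    - (a ^+ 2 * ((m - b) / m ^+ 2)).
  by field; rewrite gt_eqF.
rewrite oppr_ge0 pmulr_lle0 ?divr_gt0 ?exprn_gt0 // => a2_le0.
by apply/eqP; rewrite -sqrf_eq0 eq_le a2_le0 sqr_ge0.
Qed.

Section RealForms.
Variables (R : realFieldType) (U : lmodType R).
Implicit Types (B D : {symmetric U}) (u v : U).

Definition positive_definite D : Prop := forall u, u != 0 -> 0 < D u u.

Lemma ler_dispersion B D b d (I : finType) (a : I -> U) :
    (forall v, b * B v v <= d * D v v) ->
  b * dispersion a B <= d * dispersion a D.
Proof.
move=> leBD; rewrite -(ler_pMn2r (ltn0Sn 1)) -!mulrnAr -!sum_form_sub.
by rewrite !mulr_sumr; do 2![apply: ler_sum => ? _; rewrite ?mulr_sumr].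
Qed.

Lemma rayleigh_critical B D c u :
    (forall v, c * D v v <= B v v) -> B u u = c * D u u ->
  forall v, B u v = c * D u v.
Proof.
move=> le_cDB eq_cDB v.
have /eqP : (B u v - c * D u v) *+ 2 = 0.
  apply: (@linear_coef_eq0 _ _ (B v v - c * D v v)) => t.
  have := le_cDB (u + t *: v); rewrite -subr_ge0 !symform_addZ eq_cDB.
  by congr (_ <= _); ring.
by rewrite mulrn_eq0 subr_eq0 => /eqP.
Qed.

Definition form_eigenvalue B D (c : R) : Prop :=
  exists2 u : U, u != 0 & forall v, B u v = c * D u v.

Lemma form_eigenvalueN B D c :
  form_eigenvalue (opp_form B) D (- c) <-> form_eigenvalue B D c.
Proof.
split=> -[u u_neq0 Bu]; exists u => // v.
  by apply: oppr_inj; rewrite -mulNr -Bu.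
by rewrite /= /opp_form Bu mulNr.
Qed.

Lemma form_eigenvalue_adjoint B D (T : U -> U) c :
    positive_definite D -> (forall u v, D (T u) v = B u v) ->
  form_eigenvalue B D c <-> exists2 u, u != 0 & T u = c *: u.
Proof.
move=> D_gt0 adjT; split=> -[u u_neq0 Tu]; exists u => //.
  apply/eqP; rewrite -subr_eq0; apply/negPn/negP => /D_gt0.
  by rewrite linearBl linearZl_LR /= adjT Tu subrr ltxx.
by move=> v; rewrite -adjT Tu linearZl_LR.
Qed.

Definition rayleigh B D u : R := B u u / D u u.

Lemma rayleighZ B D t u : t != 0 -> rayleigh B D (t *: u) = rayleigh B D u.
Proof.
by move=> t_neq0; rewrite /rayleigh !symformZ -mulf_div divff ?mul1r ?sqrf_eq0.
Qed.

End RealForms.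

Lemma compact_unit_sphere (R : realType) n :
  compact [set x : 'rV[R]_n | `|x| = 1]%classic.
Proof.
apply: bounded_closed_compact.
  by exists 1; split => // M M_gt1 x /= ->; exact: ltW.
have /continuous_closedP norm_closed :=
  @norm_continuous _ ('rV[R]_n : normedModType R).
exact: norm_closed _ (@closed_eq _ (1 : R)).
Qed.

Section RayleighExtrema.
Variables (R : realType) (U : vectType R).
Implicit Types (B D : {symmetric U}) (u v : U) (c : R).

Lemma continuous_form_vecof B (e : (\dim {:U}).-tuple U) :
  continuous (fun x => B (vecof e x) (vecof e x)).
Proof.
have formE x : B (vecof e x) (vecof e x) =
    \sum_i \sum_j x 0 i * (x 0 j * B e`_i e`_j).
  rewrite linear_sumlz; apply: eq_bigr => i _.
  rewrite linear_sumr; apply: eq_bigr => j _.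
  by rewrite linearZl_LR linearZr_LR.
rewrite (eq_fun formE).
do 2![apply: continuous_big => [|? _]; first exact: add_continuous].
move=> x; apply: (@cvgM _ _ (nbhs x)); first exact: coord_continuous.
by apply: (@cvgM _ _ (nbhs x)); [exact: coord_continuous | exact: cvg_cst].
Qed.

Definition rayleigh_values B D : set R :=
  [set rayleigh B D u | u in [set u | u != 0]]%classic.

Section PositiveDefinite.
Variable D : {symmetric U}.
Hypothesis D_gt0 : positive_definite D.

Lemma rayleigh_min_attained B u0 : u0 != 0 ->
  exists2 u, u != 0 & forall v, v != 0 -> rayleigh B D u <= rayleigh B D v.
Proof.
pose e := vbasis {:U}; have e_basis : basis_of {:U} e := vbasisP _.
move=> u0_neq0; pose sphere := [set x : 'rV[R]_(\dim {:U}) | `|x| = 1]%classic.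
have vecof_neq0 x : sphere x -> vecof e x != 0.
  by move=> /= x1; rewrite vecof_eq0 // -normr_eq0 x1 oner_eq0.
have norm_neq0 v : v != 0 -> `|rVof e v| != 0.
  by rewrite normr_eq0 rVof_eq0.
have normalize v : v != 0 -> sphere (`|rVof e v|^-1 *: rVof e v).
  by move=> v_neq0; rewrite /sphere /= normrZ normfV normr_id mulVf ?norm_neq0.
have continuous_rayleigh :
    {within sphere, continuous (fun x => rayleigh B D (vecof e x))}%classic.
  apply: continuous_in_subspaceT => x /set_mem /vecof_neq0 /D_gt0 Dx_gt0.
  apply: (@cvgM _ _ (nbhs x)); first exact: continuous_form_vecof.
  by apply: cvgV; [rewrite gt_eqF | exact: continuous_form_vecof].
have [||x /set_mem sx minx] := compact_EVT_min _ _ continuous_rayleigh.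
- by eexists; exact: normalize u0_neq0.
- exact: compact_unit_sphere.
exists (vecof e x) => [|v v_neq0]; first exact: vecof_neq0.
have := minx _ (mem_set (normalize v v_neq0)).
by rewrite linearZ /= rVofK // rayleighZ // invr_neq0 ?norm_neq0.
Qed.

Lemma rayleigh_min_eigenvalue B u0 : u0 != 0 ->
  exists2 c, form_eigenvalue B D c & forall v, c * D v v <= B v v.
Proof.
move=> /(rayleigh_min_attained B) [u u_neq0 minu].
have le_cDB v : rayleigh B D u * D v v <= B v v.
  have [->|v_neq0] := eqVneq v 0; first by rewrite !linear0l mulr0.
  by rewrite -ler_pdivlMr ?D_gt0 // minu.
exists (rayleigh B D u) => //; exists u => //.
by apply: rayleigh_critical => //; rewrite divfK // gt_eqF ?D_gt0.
Qed.

Lemma min_eigenvalue_le_form B c :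
  is_min (form_eigenvalue B D) c -> forall v, c * D v v <= B v v.
Proof.
move=> [[u u_neq0 _] minc] v; have [->|v_neq0] := eqVneq v 0.
  by rewrite !linear0l mulr0.
have [d /minc le_cd le_dDB] := rayleigh_min_eigenvalue B u_neq0.
by apply: le_trans (le_dDB v); rewrite ler_pM2r ?D_gt0.
Qed.

Lemma form_le_max_eigenvalue B c :
  is_max (form_eigenvalue B D) c -> forall v, B v v <= c * D v v.
Proof.
move=> [Bc maxc] v.
suff : - c * D v v <= opp_form B v v by rewrite mulNr lerN2.
apply: min_eigenvalue_le_form; split=> [|d]; first exact/form_eigenvalueN.
by rewrite -[d]opprK => /form_eigenvalueN /maxc; rewrite lerN2.
Qed.

Lemma form_eigenvalue_rayleigh B c :
  form_eigenvalue B D c -> rayleigh_values B D c.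
Proof.
move=> [u u_neq0 Bu]; exists u => //.
by rewrite /rayleigh Bu mulfK // gt_eqF ?D_gt0.
Qed.

Lemma is_min_rayleigh B c :
  is_min (form_eigenvalue B D) c -> is_min (rayleigh_values B D) c.
Proof.
move=> minc; split=> [|_ [u /= u_neq0 <-]].
  by apply: form_eigenvalue_rayleigh; case: minc.
by rewrite ler_pdivlMr ?D_gt0 ?min_eigenvalue_le_form.
Qed.

Lemma is_max_rayleigh B c :
  is_max (form_eigenvalue B D) c -> is_max (rayleigh_values B D) c.
Proof.
move=> maxc; split=> [|_ [u /= u_neq0 <-]].
  by apply: form_eigenvalue_rayleigh; case: maxc.
by rewrite ler_pdivrMr ?D_gt0 ?form_le_max_eigenvalue.
Qed.

End PositiveDefinite.
End RayleighExtrema.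

Section HypergraphForms.
Variables (R : realType) (V : finType) (G : oriented_hypergraph V).
Implicit Types (f g : {ffun V -> R}) (h : {set V} * {set V}) (T : {set V}).

Definition energy_form f g : R :=
  \sum_(h in hyperedges G) boundary f h * boundary g h.

Definition degree_form f g : R := \sum_i (deg G i)%:R * (f i * g i).

Lemma boundary_linear h : scalar ((@boundary V R)^~ h).
Proof.
move=> a f g; rewrite /boundary; under eq_bigr do rewrite !ffunE.
under [X in _ - X]eq_bigr do rewrite !ffunE.
by rewrite !big_split /= -!scaler_sumr /GRing.scale /=; ring.
Qed.

Lemma energy_form_sym f g : energy_form f g = energy_form g f.
Proof. by apply: eq_bigr => h _; rewrite mulrC. Qed.

Lemma energy_form_linearl g : scalar (energy_form ^~ g).
Proof.
move=> a f1 f2; rewrite /energy_form mulr_sumr -big_split.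
by apply: eq_bigr => h _; rewrite boundary_linear mulrDl mulrA.
Qed.

HB.instance Definition _ := isSymmetricForm.Build R {ffun V -> R} energy_form
  energy_form_sym energy_form_linearl.

Lemma degree_form_sym f g : degree_form f g = degree_form g f.
Proof. by apply: eq_bigr => i _; rewrite [f i * _]mulrC. Qed.

Lemma degree_form_linearl g : scalar (degree_form ^~ g).
Proof.
move=> a f1 f2; rewrite /degree_form mulr_sumr -big_split.
by apply: eq_bigr => i _ /=; rewrite !ffunE /GRing.scale /=; ring.
Qed.

HB.instance Definition _ := isSymmetricForm.Build R {ffun V -> R} degree_form
  degree_form_sym degree_form_linearl.

Lemma RQ2_valueE :
  @RQ2_value V G R = rayleigh_values energy_form degree_form.
Proof. by []. Qed.

Definition indicator T : {ffun V -> R} := [ffun i => (i \in T)%:R].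

Lemma boundary_indicator T h :
  boundary (indicator T) h = #|T :&: h.1|%:R - #|T :&: h.2|%:R.
Proof.
suff sum_indicator (X : {set V}) :
    \sum_(i in X) indicator T i = #|T :&: X|%:R.
  by rewrite /boundary !sum_indicator.
under eq_bigr do rewrite ffunE.
rewrite -natr_sum -big_mkcondr -sum1_card; congr _%:R.
by apply: eq_bigl => i; rewrite inE andbC.
Qed.

Lemma energy_form_indicator T :
  energy_form (indicator T) (indicator T) = e G R T.
Proof. by apply: eq_bigr => h _; rewrite boundary_indicator. Qed.

Lemma degree_form_indicator T1 T2 :
  degree_form (indicator T1) (indicator T2) = (vol G (T1 :&: T2))%:R.
Proof.
rewrite /vol natr_sum [RHS]big_mkcond; apply: eq_bigr => i _.
by rewrite !ffunE -natrM mulnb inE; case: ifP; rewrite ?mulr1 ?mulr0.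
Qed.

Section Family.
Variables (k l : nat) (S : 'I_k -> {set V}).
Hypothesis S_family : kl_family l S.
Let U := \bigcup_(r < k) S r.

Lemma sum_indicator_family : \sum_r indicator (S r) = l%:R *: indicator U.
Proof.
apply/ffunP => i; rewrite sum_ffunE !ffunE.
under eq_bigr do rewrite ffunE.
rewrite -natr_sum -big_mkcond sum1_card.
have [/S_family <-|/bigcupP iNU] := boolP (i \in U).
  by rewrite cardsE /GRing.scale /= mulr1.
rewrite scaler0 eq_card0 // => r; apply/negP => iSr.
by case: iNU; exists r.
Qed.

Lemma dispersion_energy_family : dispersion (indicator \o S) energy_form =
  k%:R * (\sum_r e G R (S r)) - l%:R ^+ 2 * e G R U.
Proof.
rewrite /dispersion card_ord sum_indicator_family symformZ /=.
rewrite energy_form_indicator.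
by under eq_bigr do rewrite energy_form_indicator.
Qed.

Lemma dispersion_degree_family : (l <= k)%N ->
  dispersion (indicator \o S) degree_form =
  (k - l)%:R * l%:R * (vol G U)%:R.
Proof.
move=> le_lk.
have sum_degree_form :
    \sum_r degree_form (indicator (S r)) (indicator (S r)) =
    l%:R * (vol G U)%:R.
  transitivity (\sum_r degree_form (indicator (S r)) (indicator U)).
    apply: eq_bigr => r _; rewrite !degree_form_indicator finset.setIid.
    by rewrite (finset.setIidPl _) ?(finset.bigcup_sup r).
  rewrite -linear_sumlz sum_indicator_family linearZl_LR /=.
  by rewrite degree_form_indicator finset.setIid.
rewrite /dispersion card_ord sum_indicator_family symformZ /= sum_degree_form.
by rewrite degree_form_indicator finset.setIid natrB //; ring.
Qed.

End Family.

Section PositiveDegrees.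
Hypothesis deg_gt0 : forall i, (0 < deg G i)%N.

Lemma degree_form_gt0 : positive_definite degree_form.
Proof.
move=> f f_neq0.
have term_ge0 i : 0 <= (deg G i)%:R * (f i * f i).
  by rewrite mulr_ge0 ?sqr_ge0.
rewrite lt_def sumr_ge0 // andbT; apply: contra f_neq0.
rewrite psumr_eq0 // => /allP f0; apply/eqP/ffunP => i.
have := f0 i (mem_index_enum i).
by rewrite ffunE !mulf_eq0 orbb pnatr_eq0 eqn0Ngt deg_gt0 => /eqP.
Qed.

Lemma laplacian2_adjoint f g :
  degree_form (laplacian2 G f) g = energy_form f g.
Proof.
have side_sum (side : {set V} * {set V} -> {set V}) :
    \sum_i (\sum_(h in hyperedges G | i \in side h) boundary f h) * g i =
    \sum_(h in hyperedges G) boundary f h * \sum_(i in side h) g i.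
  under eq_bigr do rewrite mulr_suml.
  rewrite (exchange_big_dep (mem (hyperedges G))) /= => [|i h _ /andP[] //].
  apply: eq_bigr => h hG; rewrite mulr_sumr.
  by apply: eq_bigl => i; rewrite hG.
rewrite /energy_form /degree_form.
under eq_bigr => i _ do
  rewrite ffunE mulrA mulrCA divff ?pnatr_eq0 -?lt0n // mulr1 mulrBl.
rewrite sumrB (side_sum fst) (side_sum snd) -sumrB.
by apply: eq_bigr => h _; rewrite mulrBr.
Qed.

Lemma laplacian2_eigenvalueE :
  @laplacian2_eigenvalue V G R = form_eigenvalue energy_form degree_form.
Proof.
have adjP := form_eigenvalue_adjoint _ degree_form_gt0 laplacian2_adjoint.
apply/seteqP; split=> [a [f f_neq0 fa]|a /adjP[f f_neq0 fa]].
  by apply/adjP; exists f => //; apply/ffunP => i; rewrite fa !ffunE.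
by exists f => // i; rewrite fa ffunE.
Qed.

End PositiveDegrees.
End HypergraphForms.

Theorem theorem7p11 (R : realType) (V : finType) (G : oriented_hypergraph V)
    (deg_gt0 : forall i : V, (0 < deg G i)%N)
    (lambda1 lambdan : R)
    (lambda1_min : is_min (@laplacian2_eigenvalue V G R) lambda1)
    (lambdan_max : is_max (@laplacian2_eigenvalue V G R) lambdan) :
  [/\ is_min (@RQ2_value V G R) lambda1,
      is_max (@RQ2_value V G R) lambdan &
      forall (k l : nat) (S : 'I_k -> {set V}),
        (1 <= l)%N -> (l < k)%N ->
        kl_family l S ->
        \bigcup_(r < k) S r != finset.set0 ->
        let U := \bigcup_(r < k) S r in
        let q := (k%:R * (\sum_(r < k) e G R (S r)) - l%:R ^+ 2 * e G R U)
                 / ((k - l)%:R * l%:R * (vol G U)%:R) in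
        lambda1 <= q /\ q <= lambdan].
Proof.
have degree_gt0 := @degree_form_gt0 R V G deg_gt0.
rewrite laplacian2_eigenvalueE // in lambda1_min lambdan_max.
rewrite !RQ2_valueE; split; [exact: is_min_rayleigh|exact: is_max_rayleigh|].
move=> k l S l_gt0 lt_lk S_family U_neq0 U q.
have vol_gt0 : (0 < vol G U)%N.
  have /finset.set0Pn[i iU] := U_neq0.
  by rewrite /vol (bigD1 i) //= ltn_addr.
have den_gt0 : 0 < (k - l)%:R * l%:R * (vol G U)%:R :> R.
  by rewrite -!natrM ltr0n !muln_gt0 subn_gt0 lt_lk l_gt0.
rewrite /q ler_pdivlMr // ler_pdivrMr //.
rewrite -dispersion_energy_family // -dispersion_degree_family ?(ltnW lt_lk) //.
rewrite -[dispersion _ (energy_form G)]mul1r; split; apply: ler_dispersion => f.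
- by rewrite mul1r; exact: min_eigenvalue_le_form.
- by rewrite mul1r; exact: form_le_max_eigenvalue.
Qed.
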